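(* Let $k$ be an algebraically closed field of characteristic $0$, let $m+1\geq n\geq 4$ and let $D=\lceil\frac n2\rceil$. The (nonzero) socle elements of minimal degree in $G^{(n)}(A_m)$ occur in degree $D$. Specifically, suppose $d=(d_1,\dots,d_m)\in\mathbb{N}^m$ has $\sum_i d_i=D$. Let $\mu=(D,D)$ if $n$ is even and $\mu=(D-1,D-1,1)$ if $n$ is odd. Then every copy of $V_\mu\subset G^{(n)}(A_m)_d$ is contained in the socle of $G^{(n)}(A_m)$.
   Context: For $m,n\ge 1$, let $A_m=k[x_1,\dots,x_m]/(x_1,\dots,x_m)^2$. Its higher Galois closure is $$G^{(n)}(A_m)=k[x_{i,j}\mid 1\le i\le m,\ 1\le j\le n]/I,\qquad I=\Bigl(\sum_{j=1}^n x_{i,j}\ \Big|\ 1\le i\le m\Bigr)+\sum_{j=1}^n (x_{1,j},\dots,x_{m,j})^2 .$$ It carries a $\mathbb{Z}^m$-grading in which $x_{i,j}$ has multidegree the $i$th standard basis vector, and hence a $\mathbb{Z}$-grading in which every $x_{i,j}$ has degree $1$; $G^{(n)}(A_m)_d$ is the part of multidegree $d$. The symmetric group $S_n$ acts by $\sigma(x_{i,j})=x_{i,\sigma(j)}$, preserving each $G^{(n)}(A_m)_d$. The socle is the set of elements annihilated by all $x_{i,j}$. $V_\mu$ is the Specht module (irreducible $S_n$-representation over $k$) associated to the partition $\mu$ of $n$; a copy of $V_\mu$ is a subrepresentation isomorphic to $V_\mu$. *)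

(* Defs.v *)
From HB Require Import structures.
From mathcomp Require Import all_boot all_order all_fingroup all_algebra.
From mathcomp Require Import generic_quotient ring_quotient.
From mathcomp Require Import boolp.
From mathcomp Require Import mpoly.

Set Implicit Arguments.
Unset Strict Implicit.
Unset Printing Implicit Defensive.

Import GRing.Theory.
Local Open Scope ring_scope.
Local Open Scope quotient_scope.

(* The polynomial ring k[x_{i,j}]. The index set 'I_m * 'I_n is numbered by
   enum_rank, as {mpoly k[N]} only has variables indexed by 'I_N. *)
Definition npairs (m n : nat) : nat := #|{: 'I_m * 'I_n}|.

Notation polyG k m n := {mpoly k[npairs m n]}.

Definition polyx (k : fieldType) (m n : nat) (i : 'I_m) (j : 'I_n) :
  polyG k m n := 'X_(enum_rank (i, j)).

(* The ideal I: the terms weighted by a generate the ideal of the row sums, and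
   those weighted by b j generate the square of (x_{1,j}, ..., x_{m,j}). *)
Definition in_closure_ideal (k : fieldType) (m n : nat) (p : polyG k m n) :
  Prop :=
  exists (a : 'I_m -> polyG k m n) (b : 'I_n -> 'I_m -> 'I_m -> polyG k m n),
    p = \sum_i a i * (\sum_j polyx k i j)
      + \sum_j \sum_i \sum_i' b j i i' * (polyx k i j * polyx k i' j).

Definition closure_ideal (k : fieldType) (m n : nat) : {pred polyG k m n} :=
  fun p => `[< in_closure_ideal p >].

Lemma closure_ideal_closed (k : fieldType) (m n : nat) :
  idealr_closed (@closure_ideal k m n).
Proof.
split.
- apply/asboolP; exists (fun=> 0), (fun _ _ _ => 0).
  rewrite big1 ?add0r => [|i _]; last by rewrite mul0r.
  by rewrite big1 // => j _; rewrite big1 // => i _; rewrite big1 // => i' _;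
    rewrite mul0r.
- rewrite unfold_in; apply/asboolPn => -[a [b h]].
  have /eqP := congr1 (meval (fun=> 0)) h.
  rewrite meval1 mevalD !raddf_sum /= big1 ?add0r => [|i _]; last first.
    rewrite mevalM raddf_sum /= big1 ?mulr0 // => j _.
    by rewrite /polyx mevalXU.
  rewrite big1 ?oner_eq0 // => j _; rewrite raddf_sum big1 // => i _.
  rewrite raddf_sum big1 // => i' _.
  by rewrite /= !mevalM /polyx mevalXU mul0r mulr0.
- move=> c p q /asboolP[a [b ->]] /asboolP[a' [b' ->]]; apply/asboolP.
  exists (fun i => c * a i + a' i), (fun j i i' => c * b j i i' + b' j i i').
  rewrite mulrDr addrACA !mulr_sumr -!big_split /=; congr (_ + _).
    by apply: eq_bigr => i _; rewrite mulrDl mulrA.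
  apply: eq_bigr => j _; rewrite mulr_sumr -big_split; apply: eq_bigr => i _.
  rewrite mulr_sumr -big_split; apply: eq_bigr => i' _ /=.
  by rewrite mulrDl -!mulrA.
Qed.

HB.instance Definition _ (k : fieldType) (m n : nat) :=
  isIdealr.Build (polyG k m n) (@closure_ideal k m n)
    (@closure_ideal_closed k m n).

(* The higher Galois closure G^(n)(A_m), as a k-algebra. *)
Definition galclos (k : fieldType) (m n : nat) : Type :=
  {ideal_quot (@closure_ideal k m n)}.

HB.instance Definition _ (k : fieldType) (m n : nat) :=
  GRing.ComNzRing.on (galclos k m n).

Definition galpi (k : fieldType) (m n : nat) (p : polyG k m n) :
  galclos k m n := \pi_({ideal_quot (@closure_ideal k m n)}) p.

Section GaloisClosure.
Context {k : fieldType} {m n : nat}.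
Local Notation G := (galclos k m n).
Local Notation pi := (@galpi k m n).

Lemma galpi_is_zmod_morphism : zmod_morphism pi.
Proof. exact: rmorphB. Qed.

Lemma galpi_is_monoid_morphism : monoid_morphism pi.
Proof. by split; [exact: rmorph1 | exact: rmorphM]. Qed.

HB.instance Definition _ :=
  GRing.isZmodMorphism.Build (polyG k m n) G pi galpi_is_zmod_morphism.
HB.instance Definition _ :=
  GRing.isMonoidMorphism.Build (polyG k m n) G pi galpi_is_monoid_morphism.

Lemma galpi_surj (q : G) : pi (repr (q : {ideal_quot _})) = q.
Proof. exact: reprK. Qed.

Lemma galpi_eq (p p' : polyG k m n) :
  pi p = pi p' <-> in_closure_ideal (p - p').
Proof.
rewrite /galpi; split=> [/eqP | h].
  by rewrite -Quotient.idealrBE => /asboolP.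
by apply/eqP; rewrite -Quotient.idealrBE; apply/asboolP.
Qed.

Definition galscale (c : k) (q : G) : G := pi c%:MP * q.

Lemma galscaleA a b q : galscale a (galscale b q) = galscale (a * b) q.
Proof. by rewrite /galscale mpolyCM rmorphM mulrA. Qed.
Lemma galscale1 : left_id 1 galscale.
Proof. by move=> q; rewrite /galscale mpolyC1 rmorph1 mul1r. Qed.
Lemma galscaleDr : right_distributive galscale +%R.
Proof. by move=> c p q; rewrite /galscale mulrDr. Qed.
Lemma galscaleDl q : {morph galscale^~ q : a b / a + b}.
Proof. by move=> a b; rewrite /galscale mpolyCD rmorphD mulrDl. Qed.

HB.instance Definition _ := GRing.Zmodule_isLmodule.Build k G
  galscaleA galscale1 galscaleDr galscaleDl.

Lemma galscaleAl (c : k) (p q : G) : c *: (p * q) = (c *: p) * q.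
Proof. exact: mulrA. Qed.

HB.instance Definition _ := GRing.Lmodule_isLalgebra.Build k G galscaleAl.
HB.instance Definition _ := GRing.Lalgebra_isComAlgebra.Build k G.

Lemma galpi_is_scalable : scalable pi.
Proof. by move=> c p; rewrite -mul_mpolyC rmorphM. Qed.

HB.instance Definition _ :=
  GRing.isScalable.Build k (polyG k m n) G *:%R pi galpi_is_scalable.

Definition galx (i : 'I_m) (j : 'I_n) : G := pi (polyx k i j).

Definition in_socle (q : G) : Prop := forall i j, galx i j * q = 0.

Definition mon_multideg (u : 'X_{1..npairs m n}) (i : 'I_m) : nat :=
  (\sum_(j < n) u (enum_rank (i, j)))%N.

(* G_d, for a multidegree d and for a total degree e respectively: the classes
   of the (multi)homogeneous polynomials. *)
Definition in_multidegree (d : 'I_m -> nat) (q : G) : Prop :=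
  exists p : polyG k m n,
    (forall u, u \in msupp p -> mon_multideg u =1 d) /\ q = pi p.

Definition in_degree (e : nat) (q : G) : Prop :=
  exists p : polyG k m n, p \is e.-homog /\ q = pi p.

(* The action sigma(x_{i,j}) = x_{i,sigma(j)}. As 'S_n composes from left to
   right, (sigma * tau) acts as tau after sigma, here and below. *)
Definition polyact (s : 'S_n) (p : polyG k m n) : polyG k m n :=
  p \mPo [tuple polyx k (enum_val v).1 (s (enum_val v).2) | v < npairs m n].

Definition galact (s : 'S_n) (q : G) : G :=
  pi (polyact s (repr (q : {ideal_quot _}))).

Lemma polyact_x s i j : polyact s (polyx k i j) = polyx k i (s j).
Proof.
by rewrite /polyact /polyx comp_mpolyXU -tnth_nth tnth_mktuple enum_rankK.
Qed.

Lemma polyact_ideal s p : in_closure_ideal p -> in_closure_ideal (polyact s p).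
Proof.
case=> a [b ->].
exists (fun i => polyact s (a i)).
exists (fun j i i' => polyact s (b ((s^-1)%g j) i i')).
rewrite /polyact raddfD !raddf_sum /=; congr (_ + _).
  apply: eq_bigr => i _; rewrite rmorphM raddf_sum /=; congr (_ * _).
  rewrite [RHS](reindex_inj (@perm_inj _ s)); apply: eq_bigr => j _.
  exact: polyact_x.
rewrite [RHS](reindex_inj (@perm_inj _ s)); apply: eq_bigr => j _.
rewrite raddf_sum; apply: eq_bigr => i _; rewrite raddf_sum.
apply: eq_bigr => i' _ /=; rewrite permK !rmorphM /=.
by rewrite -!/(polyact _ _) !polyact_x.
Qed.

Lemma galact_pi s p : galact s (pi p) = pi (polyact s p).
Proof.
apply/galpi_eq; rewrite /polyact -raddfB; apply: polyact_ideal.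
by apply/galpi_eq; rewrite galpi_surj.
Qed.

Lemma galact_x s i j : galact s (galx i j) = galx i (s j).
Proof. by rewrite galact_pi polyact_x. Qed.

End GaloisClosure.

Section Specht.
Context {k : fieldType} {n : nat}.

(* A tableau of shape mu sends each entry to its cell (row, column); a tabloid
   sends each entry to its row. If mu is a partition of n, then is_tableau
   makes t a bijection onto the Young diagram of mu. *)
Definition tableau := {ffun 'I_n -> 'I_n * 'I_n}.
Definition tabloid := {ffun 'I_n -> 'I_n}.

Definition is_tableau (mu : seq nat) (t : tableau) : bool :=
  injectiveb t && [forall a, (t a).2 < nth 0%N mu (t a).1]%N.

(* sigma moves the entry a to sigma(a). *)
Definition tableau_act (s : 'S_n) (t : tableau) : tableau :=
  [ffun a => t ((s^-1)%g a)].

Definition tabloid_of (t : tableau) : tabloid := [ffun a => (t a).1].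

(* Functions on all maps from entries to rows; the permutation module M^mu is
   the subspace of the functions supported on the tabloids of shape mu. *)
Definition tabloid_space := {ffun tabloid -> k^o}.

Definition tabloid_vec (r : tabloid) : tabloid_space :=
  [ffun r' => (r' == r)%:R : k^o].

(* Linear, with sigma e_{t} = e_{sigma t} on the basis tabloid_vec. *)
Definition perm_act (s : 'S_n) (v : tabloid_space) : tabloid_space :=
  [ffun r : tabloid => v [ffun a => r (s a)]].

Definition col_stab (t : tableau) : {set 'S_n} :=
  [set s : 'S_n | [forall a, (t (s a)).2 == (t a).2]].

Definition polytabloid (t : tableau) : tabloid_space :=
  \sum_(s in col_stab t)
     (-1) ^+ odd_perm s *: tabloid_vec (tabloid_of (tableau_act s t)).

Definition specht (mu : seq nat) : {vspace tabloid_space} :=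
  <<[seq polytabloid t | t <- enum (is_tableau mu)]>>%VS.

Lemma perm_act_linear s : linear (perm_act s).
Proof. by move=> c u v; apply/ffunP => r; rewrite !ffunE. Qed.

HB.instance Definition _ s := GRing.isLinear.Build k tabloid_space tabloid_space
  *:%R (perm_act s) (perm_act_linear s).

Lemma perm_act_tabloid s t :
  perm_act s (tabloid_vec (tabloid_of t)) =
  tabloid_vec (tabloid_of (tableau_act s t)).
Proof.
apply/ffunP => r; rewrite !ffunE; congr (_ %:R); congr nat_of_bool.
apply/eqP/eqP => /ffunP h; apply/ffunP => a.
  by have := h ((s^-1)%g a); rewrite !ffunE permKV.
by have := h (s a); rewrite !ffunE permK.
Qed.

Lemma perm_act_polytabloid s t :
  perm_act s (polytabloid t) = polytabloid (tableau_act s t).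
Proof.
rewrite /polytabloid linear_sum /= [RHS](reindex_inj (@conjg_inj _ (s : 'S_n))).
apply: eq_big => [u|u _].
  rewrite !inE; apply/forallP/forallP => h a.
    by have := h ((s^-1)%g a); rewrite !ffunE /conjg !permM permK.
  by have := h (s a); rewrite !ffunE /conjg !permM !permK.
rewrite linearZ /= odd_permJ perm_act_tabloid; congr (_ *: tabloid_vec _).
apply/ffunP => a; rewrite !ffunE; congr (t _).1.
by rewrite -conjVg /conjg !permM permK.
Qed.

Lemma specht_stable mu s v : v \in specht mu -> perm_act s v \in specht mu.
Proof.
move=> hv; rewrite (coord_span hv) linear_sum; apply: memv_suml => i _.
rewrite linearZ memvZ //; apply: memv_span.
set X := [seq _ | _ <- _]; have iX : (i < size X)%N by rewrite size_map -cardE.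
have /mapP[t ht ->] := mem_nth 0 iX; rewrite /= perm_act_polytabloid.
apply/map_f; move: ht.
rewrite !mem_enum => /andP[/injectiveP ti /forallP td]; apply/andP; split.
  by apply/injectiveP => a b; rewrite !ffunE => /ti /perm_inj.
by apply/forallP => a; rewrite ffunE.
Qed.

(* specht_stable makes this the restriction of perm_act to the Specht module. *)
Definition specht_act (mu : seq nat) (s : 'S_n) (v : subvs_of (specht mu)) :
  subvs_of (specht mu) := vsproj (specht mu) (perm_act s (vsval v)).

Lemma vsval_specht_act mu s v :
  vsval (@specht_act mu s v) = perm_act s (vsval v).
Proof. by rewrite vsprojK // specht_stable // subvsP. Qed.

End Specht.

Arguments specht k n mu : clear implicits.

Section Copies.
Context {k : fieldType} {m n : nat}.
Local Notation G := (galclos k m n).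

Definition is_subrep (W : G -> Prop) : Prop :=
  [/\ W 0, forall (c : k) u v, W u -> W v -> W (c *: u + v)
    & forall s u, W u -> W (galact s u)].

Definition is_copy_of_specht (mu : seq nat) (W : G -> Prop) : Prop :=
  is_subrep W /\
  exists f : {linear subvs_of (specht k n mu) -> G},
    [/\ injective f, forall q, W q <-> exists v, f v = q
      & forall s v, f (specht_act s v) = galact s (f v)].

End Copies.

(* Main.v *)
From HB Require Import structures.
Require Import Defs.
From mathcomp Require Import all_boot all_order all_fingroup all_algebra.
From mathcomp Require Import mpoly.
From mathcomp Require Import boolp.

Set Implicit Arguments.
Unset Strict Implicit.
Unset Printing Implicit Defensive.

Import GRing.Theory.
Local Open Scope ring_scope.

(** Write G for the Galois closure and let e denote a degree. The argument
   rests on one vanishing statement and on explicit linear forms on G.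

   Vanishing. Let T be a set of positions. Modulo the row sums, the
   symmetrization over T of a product of e generators is a combination of
   products with all positions outside T (symmetrize_mon): a generator in a
   position of T is traded for minus the sum of those outside T. Two generators
   in the same position have product 0, so an element of degree e which is
   invariant under the permutations of T is 0 once e + #|T| > n. Multiplying by
   a generator in a position j outside T preserves the invariance and raises
   the degree, whence galx_inv_eq0: if q has degree e, is invariant under the
   permutations of T and n <= e + #|T|, then x_(i,j) q = 0.

   Copies of V_mu. By Maschke's theorem (equivariant_proj) an equivariant map
   defined on V_mu extends to all tabloids. The image of a tabloid is invariant
   under the permutations of each row, and one of its first two rows avoids a
   given j. Both have size n./2 = n - D, so the vanishing statement applies in
   degree D (specht_copy_socle).

   Existence. The same statement applies to a product of n./2 generators with
   the same first index, multiplied when n is odd by one generator with another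
   first index (mon_row_socle). To see that it is not 0 one needs linear forms
   on polynomials that vanish on the ideal. They are built by composing the
   evaluation at 0 with the derivations d/dx_(i,s) - d/dx_(i,t), which kill all
   the row sums; using each position once makes the form vanish on the squares
   (closure_form_pair). Antisymmetrizing a second derivative over three
   positions gives a further building block (closure_form_triple).

   Lower degrees. Let 2e < n. Since degree e is spanned by products invariant
   under the permutations of the n - e unused positions, projecting a
   permutation module equivariantly onto the preimage of the socle shows that a
   nonzero socle in degree e contains a nonzero element invariant under the
   permutations of some T with n - e elements (socle_inv). By the vanishing
   argument it is a combination of products using each of the e other positions
   once; a suitable form, applied to its product with a generator in a position
   of T, reads off any prescribed coefficient, and these must all be 0. *)

(** * Functionals vanishing on the closure ideal *)

Section Functionals.
Context {k : fieldType} {m n : nat}.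
Local Notation P := {mpoly k[npairs m n]}.
Local Notation x := (polyx k).

Definition pderiv (i : 'I_m) (s : 'I_n) (p : P) : P := p^`M(enum_rank (i, s)).

Lemma pderiv_is_linear i s : linear (pderiv i s).
Proof. by move=> c p q; rewrite /pderiv mderivD mderivZ. Qed.

HB.instance Definition _ i s :=
  GRing.isLinear.Build k P P *:%R (pderiv i s) (pderiv_is_linear i s).

Lemma pderiv_x i s i' j (p : P) :
  pderiv i s (x i' j * p) = ((i', j) == (i, s))%:R *: p + x i' j * pderiv i s p.
Proof.
rewrite /pderiv mderivM; congr (_ + _).
rewrite /polyx mderivX mnmE (inj_eq enum_rank_inj); case: eqP => [->|_].
  have -> : (U_(enum_rank (i, s)) - U_(enum_rank (i, s)) = 0)%MM.
    by apply/mnmP => v; rewrite !mnmE subnn.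
  by rewrite scale1r mpolyX0 mul1r scale1r.
by rewrite !scale0r mul0r.
Qed.

(** The derivation d/dx_(i,s) - d/dx_(i,t), which kills all the row sums. *)
Definition pair_deriv (i : 'I_m) (s t : 'I_n) (p : P) : P :=
  pderiv i s p - pderiv i t p.

Lemma pair_deriv_is_linear i s t : linear (pair_deriv i s t).
Proof.
by move=> c p q; rewrite /pair_deriv !linearP scalerDr; exact: addrACA.
Qed.

HB.instance Definition _ i s t :=
  GRing.isLinear.Build k P P *:%R (pair_deriv i s t)
    (pair_deriv_is_linear i s t).

Lemma pair_derivD i s t p q :
  pair_deriv i s t (p + q) = pair_deriv i s t p + pair_deriv i s t q.
Proof. exact: linearD. Qed.

Lemma pair_derivZ i s t c p :
  pair_deriv i s t (c *: p) = c *: pair_deriv i s t p.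
Proof. exact: linearZ. Qed.

(** The value of [pair_deriv i s t] on the variable x_(i',j). *)
Definition pair_weight (i : 'I_m) (s t : 'I_n) (i' : 'I_m) (j : 'I_n) : k :=
  ((i', j) == (i, s))%:R - ((i', j) == (i, t))%:R.

Lemma pair_deriv_x i s t i' j (p : P) :
  pair_deriv i s t (x i' j * p) =
  pair_weight i s t i' j *: p + x i' j * pair_deriv i s t p.
Proof.
by rewrite /pair_deriv /pair_weight !pderiv_x mulrBr scalerBl opprD addrACA.
Qed.

Lemma pair_weight_out i s t i' j :
  j != s -> j != t -> pair_weight i s t i' j = 0.
Proof.
move=> /negPf js /negPf jt.
by rewrite /pair_weight !xpair_eqE js jt !andbF subrr.
Qed.

Lemma pair_weight_left i s t i' :
  s != t -> pair_weight i s t i' s = (i' == i)%:R.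
Proof.
by move=> /negPf st; rewrite /pair_weight !xpair_eqE eqxx st andbT andbF subr0.
Qed.

Lemma pair_weight_right i s t i' :
  s != t -> pair_weight i s t i' t = - (i' == i)%:R.
Proof.
move=> st; rewrite /pair_weight !xpair_eqE eqxx andbT.
by rewrite [t == s]eq_sym (negPf st) andbF sub0r.
Qed.

Lemma pair_deriv_rowsum i s t i' (p : P) :
  pair_deriv i s t ((\sum_j x i' j) * p) =
  (\sum_j x i' j) * pair_deriv i s t p.
Proof.
rewrite !mulr_suml raddf_sum /=.
under eq_bigr do rewrite pair_deriv_x.
rewrite big_split /= -scaler_suml /pair_weight sumrB.
have sum_delta a : \sum_(j < n) ((i', j) == (i, a))%:R = (i' == i)%:R :> k.
  rewrite (bigD1 a) //= big1 ?addr0 => [|j /negPf ja].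
    by rewrite xpair_eqE eqxx andbT.
  by rewrite xpair_eqE ja andbF.
by rewrite !sum_delta subrr scale0r add0r.
Qed.

(** A linear form on polynomials vanishing on the closure ideal, which moreover
   does not see the variables whose position is outside [J]. *)
Record closure_form (J : {set 'I_n}) (phi : {scalar P}) : Prop := ClosureForm {
  form_rowsum : forall i p, phi ((\sum_j x i j) * p) = 0;
  form_square : forall i i' j p, phi (x i j * (x i' j * p)) = 0;
  form_out : forall i j p, j \notin J -> phi (x i j * p) = 0 }.

Lemma closure_form_ideal J phi p :
  closure_form J phi -> in_closure_ideal p -> phi p = 0.
Proof.
case=> phi_sum phi_sq _ [a [b ->]].
rewrite raddfD !raddf_sum /= big1 ?add0r => [|i _]; last by rewrite mulrC.
rewrite big1 // => j _; rewrite raddf_sum big1 // => i _.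
rewrite raddf_sum big1 // => i' _ /=.
by rewrite mulrC -mulrA phi_sq.
Qed.

Lemma closure_form_eval0 :
  exists2 phi : {scalar P}, closure_form set0 phi & phi 1 = 1.
Proof.
pose phi (p : P) := p.@[fun=> 0 : k].
have phi_lin : scalar phi.
  by move=> c p q; rewrite /phi mevalD mevalZ.
pose L := GRing.isLinear.Build k P k *%R phi phi_lin.
pose Phi : {scalar P} := HB.pack phi L.
have phi_x i j : phi (x i j) = 0 by rewrite /phi /polyx mevalXU.
exists Phi; last exact: meval1.
split=> [i p|i i' j p|i j p _] /=; rewrite [phi _]mevalM.
- rewrite raddf_sum big1 ?mul0r // => j _; exact: phi_x.
- by rewrite [_.@[_] in X in X * _]phi_x mul0r.
- by rewrite [_.@[_] in X in X * _]phi_x mul0r.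
Qed.

(** The form phi o (d/dx_(i,s) - d/dx_(i,t)), which uses two more positions. *)
Lemma closure_form_pair J (phi : {scalar P}) i s t :
  closure_form J phi -> s \notin J -> t \notin J -> s != t ->
  exists2 psi : {scalar P}, closure_form (s |: (t |: J)) psi
    & forall i' p, psi (x i' s * p) = (i' == i)%:R * phi p.
Proof.
move=> [phi_sum phi_sq phi_out] sJ tJ st.
exists (phi \o pair_deriv i s t) => /=; last first.
  move=> i' p; rewrite pair_deriv_x linearD linearZ /= phi_out // addr0.
  by rewrite pair_weight_left.
split=> [i' p|i1 i2 j p|i' j p] /=.
- by rewrite pair_deriv_rowsum phi_sum.
- rewrite !pair_deriv_x mulrDr !linearD !linearZ /= -scalerAr linearZ /=.
  rewrite phi_sq addr0.
  have [jJ|jJ] := boolP (j \in J); last by rewrite !phi_out // !mulr0 addr0.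
  have js : j != s by apply: contraNneq sJ => <-.
  have jt : j != t by apply: contraNneq tJ => <-.
  by rewrite !pair_weight_out // !mul0r addr0.
- rewrite !inE !negb_or => /and3P[js jt jJ].
  by rewrite pair_deriv_x pair_weight_out // scale0r add0r phi_out.
Qed.

(** A form using three more positions a, b, c: the composite of phi with the
   signed sum of the conjugates of d^2/dx_(i,a)dx_(i',b) under the permutations
   of {a, b, c}. *)
Lemma closure_form_triple J (phi : {scalar P}) i i' a b c :
  closure_form J phi -> a \notin J -> b \notin J -> c \notin J ->
  uniq [:: a; b; c] ->
  exists2 psi : {scalar P}, closure_form (a |: (b |: (c |: J))) psi
    & forall i1 i2 p, psi (x i1 a * (x i2 b * p)) =
        ((i1 == i)%:R * (i2 == i')%:R - (i1 == i')%:R * (i2 == i)%:R) * phi p.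
Proof.
move=> [phi_sum phi_sq phi_out] aJ bJ cJ.
rewrite /= !inE negb_or andbT => /andP[/andP[ab ac] bc].
pose D (i1 i2 : 'I_m) := pair_deriv i1 a c \o pair_deriv i2 b c.
have sum_D i1 i2 j p :
  phi (D i1 i2 ((\sum_l x j l) * p)) = 0 by rewrite /D /= !pair_deriv_rowsum.
have out_D i1 i2 (j : 'I_m) l p :
    l \notin a |: (b |: (c |: J)) -> phi (D i1 i2 (x j l * p)) = 0.
  rewrite !inE !negb_or => /and4P[la lb lc lJ].
  rewrite /D /= !pair_deriv_x !pair_weight_out // !scale0r !add0r.
  by rewrite pair_deriv_x pair_weight_out // scale0r add0r phi_out.
pose w2 i1 i2 j1 l1 j2 l2 :=
  pair_weight i1 a c j1 l1 * pair_weight i2 b c j2 l2.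
have leibniz i1 i2 (j1 j2 : 'I_m) l1 l2 p :
    l1 \notin J -> l2 \notin J ->
    phi (D i1 i2 (x j1 l1 * (x j2 l2 * p))) =
    (w2 i1 i2 j1 l1 j2 l2 + w2 i1 i2 j2 l2 j1 l1) * phi p
      + phi (x j1 l1 * (x j2 l2 * D i1 i2 p)).
  move=> l1J l2J.
  rewrite /D /= !pair_deriv_x !pair_derivD !pair_derivZ !pair_deriv_x.
  rewrite pair_derivD pair_derivZ !pair_deriv_x !mulrDr -!scalerAr.
  rewrite !(scalerDr, scalerA) !linearD !linearZ /= !phi_out //.
  rewrite /w2 !mulr0 !addr0 ?add0r.
  by rewrite addrC [RHS]mulrDl; congr (_ + _ * _); exact: mulrC.
pose psi : {scalar P} :=
  (phi \o (pair_deriv i a c \o pair_deriv i' b c)) \-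
  (phi \o (pair_deriv i' a c \o pair_deriv i b c)).
have psiE p : psi p = phi (D i i' p) - phi (D i' i p) by [].
have ba : b != a by rewrite eq_sym.
have ca : c != a by rewrite eq_sym.
have cb : c != b by rewrite eq_sym.
exists psi; last first.
  move=> i1 i2 p; rewrite psiE !leibniz // !phi_out // !addr0 -mulrBl /w2.
  congr (_ * _).
  rewrite ![pair_weight _ a c i2 b]pair_weight_out // !mul0r !addr0.
  by rewrite !pair_weight_left.
split=> [j p|j1 j2 l p|j l p lJ]; rewrite psiE.
- by rewrite !sum_D subrr.
- have [lJ|lJ] := boolP (l \in J); last first.
    rewrite !leibniz // !phi_sq !addr0 -mulrBl.
    suff -> : w2 i i' j1 l j2 l + w2 i i' j2 l j1 l =
              w2 i' i j1 l j2 l + w2 i' i j2 l j1 l by rewrite subrr mul0r.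
    rewrite /w2; have [-> | lc] := eqVneq l c.
      (* Only the position c carries two derivatives; there the two terms of
         the alternating sum agree. *)
      rewrite !pair_weight_right // !mulrNN addrC.
      by congr (_ + _); exact: mulrC.
    have [lb|lb] := eqVneq l b.
      by rewrite lb ![pair_weight _ a c _ b]pair_weight_out // !mul0r.
    by rewrite ![pair_weight _ b c _ l]pair_weight_out // !mulr0.
  have la : l != a by apply: contraNneq aJ => <-.
  have lb : l != b by apply: contraNneq bJ => <-.
  have lc : l != c by apply: contraNneq cJ => <-.
  rewrite /D /= !(pair_deriv_x, pair_weight_out, scale0r, add0r) //.
  by rewrite !phi_sq subrr.
- by rewrite !out_D // subrr.
Qed.

End Functionals.

Section FormsOnMonomials.
Context {k : fieldType} {m n : nat}.
Local Notation P := {mpoly k[npairs m n]}.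
Local Notation x := (polyx k).

(** The product of the variables x_(i,j) over a sequence of pairs (i,j). *)
Definition poly_mon (l : seq ('I_m * 'I_n)) : P := \prod_(a <- l) x a.1 a.2.

Lemma poly_mon_cons a l : poly_mon (a :: l) = x a.1 a.2 * poly_mon l.
Proof. by rewrite /poly_mon big_cons. Qed.

Lemma closure_form_pairs (J : {set 'I_n}) (phi : {scalar P})
    (ss ts : seq 'I_n) (c0 : seq 'I_m) :
  closure_form J phi -> size ts = size ss -> size c0 = size ss ->
  uniq (ss ++ ts) -> {in ss ++ ts, forall a, a \notin J} ->
  exists2 psi : {scalar P}, closure_form (J :|: [set a in ss ++ ts]) psi
    & forall c p, size c = size ss ->
        psi (poly_mon (zip c ss) * p) = (c == c0)%:R * phi p.
Proof.
move=> phiJ; elim: ss ts c0 => [|s ss IH] [|t ts] [|i c0] //=.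
  move=> _ _ _ _; exists phi => [|[] // p _]; last first.
    by rewrite /poly_mon big_nil !mul1r.
  suff -> : [set a in [::]] = set0 :> {set 'I_n} by rewrite setU0.
  by apply/setP=> a; rewrite !inE.
case=> tss [c0ss] /andP[sNin uniq_st] outJ.
have perm_st : perm_eq (ss ++ t :: ts) (t :: ss ++ ts).
  by rewrite -cat_rcons -cats1 -catA perm_catCA.
rewrite (perm_uniq perm_st) /= in uniq_st.
rewrite (perm_mem perm_st) inE negb_or in sNin.
have memE a : (a \in s :: ss ++ t :: ts) = [|| a == s, a == t | a \in ss ++ ts].
  by rewrite inE (perm_mem perm_st) inE.
case/andP: uniq_st => tNin uniq_st; case/andP: sNin => st sNin.
have [a ain|psi psiJ psiE] := IH ts c0 tss c0ss uniq_st.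
  by apply: outJ; rewrite memE ain !orbT.
have sJ : s \notin J :|: [set a in ss ++ ts].
  by rewrite inE negb_or outJ ?memE ?eqxx // inE.
have tJ : t \notin J :|: [set a in ss ++ ts].
  by rewrite inE negb_or outJ ?memE ?eqxx ?orbT // inE.
have [psi' psi'J psi'E] := closure_form_pair i psiJ sJ tJ st.
exists psi' => [|[|i' c] // p [cs]].
  suff -> : J :|: [set a in s :: ss ++ t :: ts] =
            s |: (t |: (J :|: [set a in ss ++ ts])) by [].
  apply/setP=> a; rewrite !(in_setU, in_set1, in_set) memE.
  by rewrite orbCA; congr (_ || _); rewrite orbCA.
rewrite /= poly_mon_cons -mulrA psi'E psiE // eqseq_cons mulrA.
by case: (i' == i); rewrite ?mul1r ?mul0r.
Qed.

(** Multiplication by a suitable variable in a further position [b] keeps apart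
   the products of one variable in each position of [ss]. The first position of
   [ss] is antisymmetrized with [b] and [t], each other one with its partner in
   [ts]; the index [i] differs from the first one of [c0] so that the
   antisymmetrization over three positions does not vanish. *)
Lemma closure_form_detect (b t : 'I_n) (ss ts : seq 'I_n) (c0 : seq 'I_m) :
  (1 < m)%N -> uniq [:: b, t & ss ++ ts] -> size ts = (size ss).-1 ->
  size c0 = size ss ->
  exists i J (psi : {scalar P}), closure_form J psi /\
    forall c, size c = size ss ->
      psi (x i b * poly_mon (zip c ss)) = (c == c0)%:R.
Proof.
move=> m_gt1; have [phi0 phi0J phi0E] := @closure_form_eval0 k m n.
case: ss c0 => [|a ss] [|i0 c0] //=.
  rewrite inE negb_or => /andP[/andP[bt _] _] _ _.
  pose i : 'I_m := Ordinal m_gt1.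
  have [||psi psiJ psiE] := closure_form_pair i phi0J _ _ bt.
  - by rewrite inE.
  - by rewrite inE.
  exists i, (b |: (t |: set0)), psi; split=> // -[] // _.
  by rewrite psiE eqxx mul1r /= /poly_mon big_nil phi0E.
rewrite !inE !negb_or.
case/and4P=> /and3P[bt ba bst] /andP[ta tst] ast uniq_st tss [c0ss].
have [i i_neq] : exists i : 'I_m, i != i0.
  have [i0_0 | i0_n0] := eqVneq (i0 : nat) 0%N.
    by exists (Ordinal m_gt1); rewrite -val_eqE /= i0_0.
  by exists (Ordinal (ltnW m_gt1)); rewrite -val_eqE /= eq_sym.
have [||||psi psiJ psiE] :=
  @closure_form_triple k m n set0 phi0 i0 i a b t phi0J.
- by rewrite inE.
- by rewrite inE.
- by rewrite inE.
- by rewrite /= !inE negb_or [a == b]eq_sym ba [a == t]eq_sym ta bt.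
have [v vin|psi' psi'J psi'E] := closure_form_pairs psiJ tss c0ss uniq_st.
  rewrite !inE orbF !negb_or.
  by apply/and3P; split; apply: contraTneq vin => ->.
exists i, (a |: (b |: (t |: set0)) :|: [set v in ss ++ ts]), psi'.
split=> // -[|i' c] // [cs]; rewrite /= poly_mon_cons.
rewrite mulrA mulrC psi'E //= mulrC -[x i b * _]mulr1 [x i b * _]mulrC -mulrA.
rewrite psiE phi0E eqxx !mulr1 [i == i0](negPf i_neq) mulr0 subr0 eqseq_cons.
by case: (i' == i0); rewrite ?mul1r ?mul0r.
Qed.

End FormsOnMonomials.

(** * Monomials in the Galois closure *)

Section Monomials.
Context {k : fieldType} {m n : nat}.
Local Notation G := (galclos k m n).
Local Notation pi := (@galpi k m n).
Local Notation pair := ('I_m * 'I_n)%type.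
Local Notation galx := (@galx k m n).

Lemma polyact_sub s (p q : {mpoly k[npairs m n]}) :
  polyact s (p - q) = polyact s p - polyact s q.
Proof. exact: raddfB. Qed.

Lemma galact_is_zmod_morphism s : zmod_morphism (@galact k m n s).
Proof.
move=> p q; rewrite -[p]galpi_surj -[q]galpi_surj -rmorphB !galact_pi.
by rewrite -rmorphB polyact_sub.
Qed.

HB.instance Definition _ s :=
  GRing.isZmodMorphism.Build G G (@galact k m n s) (galact_is_zmod_morphism s).

Lemma galact_is_monoid_morphism s : monoid_morphism (@galact k m n s).
Proof.
split=> [|p q].
  by rewrite -[1 in LHS](rmorph1 pi) galact_pi /polyact comp_mpoly1 rmorph1.
rewrite -[p]galpi_surj -[q]galpi_surj -rmorphM !galact_pi -rmorphM.
by congr (pi _); exact: rmorphM.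
Qed.

HB.instance Definition _ s :=
  GRing.isMonoidMorphism.Build G G (@galact k m n s)
    (galact_is_monoid_morphism s).

Lemma galact_is_scalable s : scalable (@galact k m n s).
Proof.
move=> c p; rewrite -[p]galpi_surj -linearZ !galact_pi -linearZ.
by congr (pi _); exact: linearZ.
Qed.

HB.instance Definition _ s :=
  GRing.isScalable.Build k G G *:%R (@galact k m n s) (galact_is_scalable s).

Lemma galx_rowsum i : \sum_j galx i j = 0.
Proof.
rewrite -raddf_sum -(rmorph0 pi); apply/galpi_eq; rewrite subr0.
exists (fun i' => (i' == i)%:R), (fun _ _ _ => 0).
rewrite [X in _ + X]big1 ?addr0 => [|j _]; last first.
  by rewrite big1 // => i1 _; rewrite big1 // => i2 _; rewrite mul0r.
rewrite (bigD1 i) //= eqxx mul1r [X in _ + X]big1 ?addr0 // => i' /negPf ->.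
by rewrite mul0r.
Qed.

Lemma galx_square i i' j : galx i j * galx i' j = 0.
Proof.
rewrite -rmorphM -(rmorph0 pi); apply/galpi_eq; rewrite subr0.
exists (fun=> 0), (fun j1 i1 i2 => ((j1, i1, i2) == (j, i, i'))%:R).
rewrite big1 ?add0r => [|i1 _]; last by rewrite mul0r.
rewrite (bigD1 j) //= [X in _ + X]big1 ?addr0 => [|j1 /negPf j1j]; last first.
  rewrite big1 // => i1 _; rewrite big1 // => i2 _.
  by rewrite !xpair_eqE j1j mul0r.
rewrite (bigD1 i) //= [X in _ + X]big1 ?addr0 => [|i1 /negPf i1i]; last first.
  by rewrite big1 // => i2 _; rewrite !xpair_eqE i1i andbF mul0r.
rewrite (bigD1 i') //= [X in _ + X]big1 ?addr0 => [|i1 /negPf i1i]; last first.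
  by rewrite !xpair_eqE i1i andbF mul0r.
by rewrite eqxx mul1r.
Qed.

(** The product of the generators x_(i,j) over a sequence of pairs (i,j). *)
Definition mon (l : seq pair) : G := \prod_(a <- l) galx a.1 a.2.

Lemma mon_cons a l : mon (a :: l) = galx a.1 a.2 * mon l.
Proof. by rewrite /mon big_cons. Qed.

Lemma perm_mon l1 l2 : perm_eq l1 l2 -> mon l1 = mon l2.
Proof. exact: perm_big. Qed.

Lemma galpi_poly_mon l : pi (poly_mon l) = mon l.
Proof. by rewrite /poly_mon rmorph_prod. Qed.

(** The action of permutations on the indices of the generators. *)
Definition perm_pair (s : 'S_n) (a : pair) : pair := (a.1, s a.2).

Lemma galact_mon s l : galact s (mon l) = mon (map (perm_pair s) l).
Proof.
by rewrite /mon rmorph_prod big_map; apply: eq_bigr => a _; exact: galact_x.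
Qed.

Lemma galx_mon0 i j l : j \in unzip2 l -> galx i j * mon l = 0.
Proof.
elim: l => [|[i' j'] l IH] //=; rewrite inE mon_cons.
case/predU1P=> [->|/IH jl]; first by rewrite mulrA galx_square mul0r.
by rewrite mulrCA jl mulr0.
Qed.

Lemma mon_uniq0 l : ~~ uniq (unzip2 l) -> mon l = 0.
Proof.
elim: l => [|[i j] l IH] //=; rewrite negb_and negbK mon_cons.
by case/orP=> [/galx_mon0->//|/IH->]; rewrite mulr0.
Qed.

(** The span of the products of [e] generators with positions outside [T]. *)
Inductive mon_span (T : {set 'I_n}) (e : nat) : G -> Prop :=
| MonSpan0 : mon_span T e 0
| MonSpanZD c u v :
    mon_span T e u -> mon_span T e v -> mon_span T e (c *: u + v)
| MonSpan_mon l :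
    size l = e -> all [predC T] (unzip2 l) -> mon_span T e (mon l).

Lemma mon_spanZ T e c u : mon_span T e u -> mon_span T e (c *: u).
Proof.
by move=> uT; rewrite -[_ *: _]addr0; apply: MonSpanZD uT (MonSpan0 _ _).
Qed.

Lemma mon_spanD T e u v :
  mon_span T e u -> mon_span T e v -> mon_span T e (u + v).
Proof. by move=> uT vT; rewrite -[u]scale1r; apply: MonSpanZD. Qed.

Lemma mon_span_sum T e I (r : seq I) (Q : pred I) (F : I -> G) :
  (forall i, Q i -> mon_span T e (F i)) ->
  mon_span T e (\sum_(i <- r | Q i) F i).
Proof.
by move=> FT; apply: big_ind => //; [exact: MonSpan0 | exact: mon_spanD].
Qed.

(** Only [#|~: T|] positions are available, and none can be used twice. *)
Lemma mon_span_eq0 (T : {set 'I_n}) e q :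
  mon_span T e q -> (n < e + #|T|)%N -> q = 0.
Proof.
move=> qT lt_n; elim: qT => [//|c u v _ -> _ ->|l le_l lT].
  by rewrite scaler0 addr0.
rewrite -le_l in lt_n.
apply: mon_uniq0; apply: contraTN lt_n => /card_uniqP ul.
rewrite -leqNgt -(size_map snd l) -/(unzip2 l) -ul.
have /subset_leq_card : unzip2 l \subset ~: T.
  by apply/subsetP => j /(allP lT); rewrite !inE.
rewrite cardsCs setCK card_ord => sub_l.
have := leq_add sub_l (leqnn #|T|).
by rewrite subnK // -[n in (_ <= n)%N]card_ord max_card.
Qed.

(** The sum of the translates of [q] under the permutations supported in [T]. *)
Definition symmetrize (T : {set 'I_n}) (q : G) : G :=
  \sum_(s | perm_on T s) galact s q.

Lemma symmetrize_is_linear T : linear (symmetrize T).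
Proof.
move=> c p q; rewrite /symmetrize scaler_sumr -big_split.
by apply: eq_bigr => s _; rewrite linearP.
Qed.

HB.instance Definition _ T :=
  GRing.isLinear.Build k G G *:%R (symmetrize T) (symmetrize_is_linear T).

Lemma symmetrize_perm (T : {set 'I_n}) s l : perm_on T s ->
  symmetrize T (mon (map (perm_pair s) l)) = symmetrize T (mon l).
Proof.
move=> sT; rewrite /symmetrize [RHS](reindex_inj (@mulgI _ s)) /=.
have sSym : s \in Sym T by rewrite inE.
apply: eq_big => [t|t _].
  by have := @groupMl _ (Sym_group T) s t sSym; rewrite !inE.
rewrite !galact_mon -map_comp; congr mon; apply: eq_map => a.
by rewrite /perm_pair /= permM.
Qed.

(** A factor x_(i,s) with [s] in [T] can be replaced, up to a nonzero scalar,
   with the sum of the x_(i,t), [t] not in [T]: modulo the row sums this is the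
   opposite of the sum of the x_(i,t) with [t] in [T]; the terms with [t]
   already used vanish, and the others all have the same symmetrization. *)
Lemma symmetrize_mon (T : {set 'I_n}) l : [pchar k] =i pred0 ->
  mon_span T (size l) (symmetrize T (mon l)).
Proof.
move=> char0; have [N] := ubnP (count (mem T) (unzip2 l)).
elim: N l => // N IH l; rewrite ltnS => le_N.
have [ul|/mon_uniq0->] := boolP (uniq (unzip2 l)); last first.
  by rewrite linear0; exact: MonSpan0.
have [/allP lT|] := boolP (all [predC T] (unzip2 l)).
  apply: mon_span_sum => s sT; rewrite galact_mon.
  apply: MonSpan_mon; first by rewrite size_map.
  rewrite /unzip2 -map_comp; apply/allP => j /mapP[a al ->] /=.
  have aT : a.2 \notin T by apply: lT; exact: map_f.
  by rewrite (out_perm sT aT).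
case/allPn => s /mapP[[i s'] al /= ->{s}]; rewrite negbK => sT.
rewrite (perm_mon (perm_to_rem al)); set l' := rem _ l.
have pl : perm_eq (unzip2 l) (s' :: unzip2 l').
  by have := perm_map snd (perm_to_rem al).
have size_l : size l = (size l').+1.
  by have := perm_size (perm_to_rem al).
rewrite (perm_uniq pl) /= in ul; case/andP: ul => sl' ul'.
have sum_T : \sum_(t in T | t \notin unzip2 l') mon ((i, t) :: l') =
             - \sum_(t | t \notin T) mon ((i, t) :: l').
  apply/eqP; rewrite -addr_eq0; apply/eqP.
  transitivity ((\sum_t galx i t) * mon l'); last by rewrite galx_rowsum mul0r.
  rewrite mulr_suml [RHS](bigID [pred t | t \in T]) /=; congr (_ + _).
    rewrite [RHS](bigID [pred t | t \notin unzip2 l']) /=.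
    rewrite [X in _ + X]big1 ?addr0 => [|t /andP[_]]; last first.
      by rewrite negbK; exact: galx_mon0.
    by apply: eq_bigr => t _; rewrite mon_cons.
  by apply: eq_bigr => t _; rewrite mon_cons.
have sym_const t : t \in T -> t \notin unzip2 l' ->
    symmetrize T (mon ((i, t) :: l')) = symmetrize T (mon ((i, s') :: l')).
  move=> tT tl'; rewrite -(@symmetrize_perm T (tperm s' t)); last first.
    apply: subset_trans (tperm_on s' t) _; apply/subsetP => j.
    by rewrite !inE => /orP[]/eqP->.
  rewrite /= {1}/perm_pair /= tpermR; congr (symmetrize T (mon (_ :: _))).
  rewrite -[RHS]map_id; apply/eq_in_map => -[i1 j1] al'.
  rewrite /perm_pair /= tpermD //.
    by apply: contraTneq (map_f snd al') => /= <-.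
  by apply: contraTneq (map_f snd al') => /= <-.
pose Q := [pred t | (t \in T) && (t \notin unzip2 l')].
have sum_Q : symmetrize T (mon ((i, s') :: l')) *+ #|Q| =
             - \sum_(t | t \notin T) symmetrize T (mon ((i, t) :: l')).
  rewrite -linear_sum -linearN -sum_T linear_sum -sumr_const.
  apply: eq_big => [t|t]; first by rewrite inE.
  by rewrite inE => /andP[tT tl']; exact: esym (sym_const t tT tl').
have Q_neq0 : #|Q|%:R != 0 :> k.
  rewrite (pcharf0P k).1 // -lt0n; apply/card_gt0P; exists s'.
  by rewrite inE sT sl'.
rewrite -[symmetrize T _](scalerK Q_neq0) scaler_nat sum_Q.
apply: mon_spanZ; rewrite -scaleN1r; apply: mon_spanZ.
apply: mon_span_sum => t tT; rewrite size_l.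
apply: (IH ((i, t) :: l')); rewrite /= (negPf tT) add0n.
by rewrite (seq.permP pl) /= sT add1n in le_N.
Qed.

(** An element invariant under the permutations of [T] is a multiple of its
   symmetrization. *)
Lemma mon_span_inv (T : {set 'I_n}) e q : [pchar k] =i pred0 ->
  mon_span set0 e q -> (forall s, perm_on T s -> galact s q = q) ->
  mon_span T e q.
Proof.
move=> char0 qe qT.
have sym_q : symmetrize T q = q *+ #|T|`!.
  rewrite -card_perm -sumr_const; apply: eq_bigr => s; exact: qT.
have fact_neq0 : #|T|`!%:R != 0 :> k.
  by rewrite (pcharf0P k).1 // -lt0n fact_gt0.
rewrite -[q](scalerK fact_neq0) scaler_nat -sym_q; apply: mon_spanZ.
elim: qe => [|c u v _ uT _ vT|l <- _].
- by rewrite linear0; exact: MonSpan0.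
- by rewrite linearP; exact: MonSpanZD.
- exact: symmetrize_mon.
Qed.

Lemma mon_span_galx e i j q :
  mon_span set0 e q -> mon_span set0 e.+1 (galx i j * q).
Proof.
elim=> [|c u v _ uT _ vT|l <- _].
- by rewrite mulr0; exact: MonSpan0.
- by rewrite mulrDr -scalerAr; exact: MonSpanZD.
- rewrite -[galx i j]/(galx (i, j).1 (i, j).2) -mon_cons.
  by apply: MonSpan_mon => //; apply/allP => a _; rewrite !inE.
Qed.

(** An element of degree [e] invariant under the permutations of at least
   [n - e] positions [T] is killed by the generators with position outside
   [T]. *)
Lemma galx_inv_eq0 (T : {set 'I_n}) e i j q : [pchar k] =i pred0 ->
  mon_span set0 e q -> (forall s, perm_on T s -> galact s q = q) ->
  (n <= e + #|T|)%N -> j \notin T -> galx i j * q = 0.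
Proof.
move=> char0 qe qT le_n jT; apply: (@mon_span_eq0 T e.+1) => //.
apply: mon_span_inv => // [|s sT]; first exact: mon_span_galx.
by rewrite rmorphM /= qT // galact_x (out_perm sT jT).
Qed.

Lemma mon_span_sum_mon (I : finType) (F : I -> G) (T : {set 'I_n}) e q :
  (forall l, size l = e -> all [predC T] (unzip2 l) ->
     mon l = 0 \/ exists i, mon l = F i) ->
  mon_span T e q -> exists a : {ffun I -> k}, q = \sum_i a i *: F i.
Proof.
move=> monF; elim=> [|c u v _ [a ->] _ [b ->]|l le lT].
- by exists [ffun=> 0]; rewrite big1 // => i _; rewrite ffunE scale0r.
- exists [ffun i => c * a i + b i]; rewrite scaler_sumr -big_split.
  by apply: eq_bigr => i _; rewrite ffunE scalerDl scalerA.
- case: (monF l le lT) => [->|[i ->]].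
    by exists [ffun=> 0]; rewrite big1 // => i _; rewrite ffunE scale0r.
  exists [ffun i' => (i' == i)%:R]; rewrite (bigD1 i) //= ffunE eqxx scale1r.
  rewrite big1 ?addr0 // => i' /negPf i'i.
  by rewrite ffunE i'i scale0r.
Qed.

(** If exactly [e] positions lie outside [T], only the products using each of
   them once survive; these are indexed by the tuples of first indices. *)
Lemma mon_span_full (T : {set 'I_n}) e q : size (enum (~: T)) = e ->
  mon_span T e q -> exists a : {ffun e.-tuple 'I_m -> k},
    q = \sum_c a c *: mon (zip c (enum (~: T))).
Proof.
move=> sizeT; apply: mon_span_sum_mon => l le /allP lT.
have [ul|/mon_uniq0] := boolP (uniq (unzip2 l)); last by left.
right; pose ss := enum (~: T).
have pl : perm_eq (unzip2 l) ss.
  apply: uniq_perm => //; first exact: enum_uniq.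
  have sub_l : {subset unzip2 l <= ss}.
    by move=> j /lT; rewrite mem_enum !inE.
  by apply: (uniq_min_size ul sub_l _).2; rewrite size_map le sizeT.
case: l => [|a0 l0] in le lT ul pl *.
  have ss0 : ss = [::] by apply/perm_nilP; rewrite perm_sym.
  exists (tcast le [tuple]); rewrite -/ss ss0.
  by case: e / le {sizeT} => /=.
set l := a0 :: l0 in le lT ul pl *.
pose f s := nth a0 l (index s (unzip2 l)).
have lE : map f (unzip2 l) = l.
  apply: (@eq_from_nth _ a0) => [|r]; rewrite !size_map // => r_lt.
  by rewrite (nth_map a0.2) ?size_map // /f index_uniq ?size_map.
have f2 s : s \in ss -> (f s).2 = s.
  rewrite -(perm_mem pl) => sl.
  have sl_lt : (index s (unzip2 l) < size l)%N.
    by rewrite -(size_map snd) index_mem.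
  by rewrite /f -(nth_map a0 a0.2 snd sl_lt) nth_index.
have zE : zip (map (fst \o f) ss) ss = map f ss.
  rewrite -[RHS]zip_unzip /unzip1 /unzip2 -!map_comp; congr zip.
  by rewrite -[LHS]map_id; apply/eq_in_map => s /f2.
have sizec : size (map (fst \o f) ss) == e by rewrite size_map sizeT.
exists (Tuple sizec); rewrite /= zE -{1}lE.
by apply: perm_mon; exact: perm_map.
Qed.

End Monomials.

Section Degrees.
Context {k : fieldType} {m n : nat}.
Local Notation G := (galclos k m n).
Local Notation pi := (@galpi k m n).

Lemma galpi_monomial (u : 'X_{1..npairs m n}) :
  exists2 l, size l = mdeg u & pi 'X_[u] = mon l.
Proof.
have [d] := ubnP (mdeg u); elim: d u => // d IH u.
have [v uv|u0] := pickP (fun v => u v != 0%N); last first.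
  move=> _; have -> : u = 0%MM.
    by apply/mnmP => v; rewrite mnmE; apply/eqP/negPn; rewrite u0.
  by exists [::]; rewrite ?mdeg0 // mpolyX0 rmorph1 /mon big_nil.
have uE : (U_(v) + (u - U_(v)))%MM = u by rewrite addmC submK // lep1mP.
rewrite -{}uE mdegD mdeg1 add1n ltnS => /IH[l sl piu].
exists (enum_val v :: l); first by rewrite /= sl.
rewrite mpolyXD rmorphM /= piu mon_cons; congr (_ * _).
by rewrite /galx /polyx -surjective_pairing enum_valK.
Qed.

Lemma in_degree_mon_span e (q : G) : in_degree e q -> mon_span set0 e q.
Proof.
case=> p [/dhomogP p_homog ->]; rewrite [p]mpolyE raddf_sum big_seq.
apply: mon_span_sum => u up; rewrite /= linearZ /=; apply: mon_spanZ.
have [l sl ->] := galpi_monomial u; apply: MonSpan_mon.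
  by rewrite sl; exact: p_homog.
by apply/allP => a _; rewrite !inE.
Qed.

Lemma in_degree_mon l : in_degree (size l) (mon l : G).
Proof.
exists (poly_mon l); split; last by rewrite galpi_poly_mon.
elim: l => [|a l IH]; first by rewrite /poly_mon big_nil dhomog1.
rewrite poly_mon_cons [size _]/= -add1n; apply: dhomogM => //.
rewrite dhomogX; apply/eqP; exact: mdeg1.
Qed.

Lemma in_multidegree_degree d (q : G) :
  in_multidegree d q -> in_degree (\sum_i d i) q.
Proof.
case=> p [p_multi ->]; exists p; split=> //; apply/dhomogP => u up.
under eq_bigr do rewrite -(p_multi u up) /mon_multideg.
rewrite pair_big /= mdegE (reindex (@enum_rank _)) /=; last first.
  by apply: onW_bij; exact: enum_rank_bij.
by apply: eq_bigr => -[].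
Qed.

End Degrees.

(** * Averaging a projection over the symmetric group *)

Section Averaging.
Context {k : fieldType} {n : nat} (F : vectType k).

(** A linear subspace given by a Prop-valued predicate is some vector space:
   take one of maximal dimension among those satisfying the predicate. *)
Lemma vspace_of_pred (Q : F -> Prop) :
  Q 0 -> (forall (c : k) u v, Q u -> Q v -> Q (c *: u + v)) ->
  exists V : {vspace F}, forall v, v \in V <-> Q v.
Proof.
move=> Q0 Qlin.
pose sub (V : {vspace F}) := forall v, v \in V -> Q v.
pose dims d := `[< exists2 V, sub V & \dim V = d >].
have ex_dims : exists d, dims d.
  exists 0%N; apply/asboolP; exists 0%VS; last exact: dimv0.
  by move=> v; rewrite memv0 => /eqP->.
have le_dims d : dims d -> (d <= \dim {:F})%N.
  by move=> /asboolP[V _ <-]; apply/dimvS/subvf.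
have [_ /asboolP[V subV <-] maxV] := ex_maxnP ex_dims le_dims.
exists V => v; split=> [/subV//|Qv].
have /maxV : dims (\dim (V + <[v]>)).
  apply/asboolP; exists (V + <[v]>)%VS => // w.
  move=> /memv_addP[u uV [w' /vlineP[c ->] ->]].
  by rewrite addrC; apply: Qlin => //; exact: subV.
move=> le_V; have /eqP-> : V == (V + <[v]>)%VS by rewrite eqEdim addvSl.
by rewrite memvE addvSr.
Qed.

(** Maschke's theorem for the symmetric group: an invariant subspace is the
   image of an equivariant projection. *)
Lemma equivariant_proj (rho : 'S_n -> {linear F -> F}) (V : {vspace F}) :
  [pchar k] =i pred0 ->
  (forall v, rho 1%g v = v) ->
  (forall s t v, rho (s * t)%g v = rho t (rho s v)) ->
  (forall s v, v \in V -> rho s v \in V) ->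
  exists P : {linear F -> F},
    [/\ forall v, P v \in V, forall v, v \in V -> P v = v
      & forall s v, P (rho s v) = rho s (P v)].
Proof.
move=> char0 rho1 rhoM rhoV.
have fact_neq0 : #|{: 'S_n}|%:R != 0 :> k.
  rewrite (pcharf0P k).1 // -lt0n; apply/card_gt0P; exists 1%g.
  by rewrite inE.
pose avg v := #|{: 'S_n}|%:R^-1 *: \sum_s rho s^-1%g (projv V (rho s v)).
have avg_lin : linear avg.
  move=> c u v; rewrite /avg scalerA mulrC -scalerA -scalerDr; congr (_ *: _).
  rewrite scaler_sumr -big_split; apply: eq_bigr => s _.
  by rewrite !linearP.
pose L := GRing.isLinear.Build k F F *:%R avg avg_lin.
pose P : {linear F -> F} := HB.pack avg L.
exists P; split=> [v|v vV|s v].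
- by apply: memvZ; apply: memv_suml => s _; apply/rhoV/memv_proj.
- rewrite /= /avg (eq_bigr (fun=> v)) => [|s _].
    by rewrite sumr_const -scaler_nat scalerK.
  by rewrite projv_id ?rhoV // -rhoM mulgV rho1.
- rewrite /= /avg [RHS]linearZ; congr (_ *: _); rewrite [RHS]linear_sum.
  rewrite [RHS](reindex_inj (@mulgI _ s)); apply: eq_bigr => t _ /=.
  by rewrite -rhoM invMg -[rho s _]rhoM mulgKV.
Qed.

End Averaging.

(** * Socle elements of minimal degree *)

Section Socle.
Context {k : fieldType} {m n : nat}.
Context (char0 : [pchar k] =i pred0).
Local Notation G := (galclos k m n).
Local Notation pi := (@galpi k m n).
Local Notation pair := ('I_m * 'I_n)%type.

(** A product of [e] generators lies in the socle if at least [n - e] of them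
   have the same first index and distinct positions, not used by the others: it
   is invariant under the permutations of these positions, and a generator in
   one of them kills it as two generators in the same position have product
   0. *)
Lemma mon_row_socle (i0 : 'I_m) (l0 : seq pair) (ss : seq 'I_n) :
  uniq ss -> {in unzip2 l0, forall a, a \notin ss} ->
  (n <= size l0 + size ss + size ss)%N ->
  in_socle (mon (l0 ++ [seq (i0, s) | s <- ss]) : G).
Proof.
move=> uss l0ss le_n i j; set l := l0 ++ _.
have [jss | jss] := boolP (j \in ss).
  apply: galx_mon0; rewrite /unzip2 map_cat mem_cat -map_comp.
  by apply/orP; right; apply/mapP; exists j.
have cardT : #|[set a in ss]| = size ss by rewrite cardsE (card_uniqP uss).
apply: (@galx_inv_eq0 _ _ _ [set a in ss] (size l)) => //.
- by apply: MonSpan_mon => //; apply/allP => a _; rewrite !inE.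
- move=> s sT; rewrite galact_mon map_cat -map_comp; apply: perm_mon.
  have l0_fix : map (perm_pair s) l0 = l0.
    rewrite -[RHS]map_id; apply/eq_in_map => -[i1 j1] al0.
    have j1T : j1 \notin [set a in ss].
      by rewrite inE; apply: l0ss (map_f snd al0).
    by rewrite /perm_pair /= (out_perm sT j1T).
  rewrite l0_fix perm_cat2l (map_comp (fun a => (i0, a)) s); apply: perm_map.
  apply: uniq_perm => //; first by rewrite map_inj_uniq //; exact: perm_inj.
  have sub_ss : {subset map s ss <= ss}.
    move=> _ /mapP[a ass ->]; have := perm_closed a sT.
    by rewrite !inE ass.
  have us : uniq (map s ss) by rewrite map_inj_uniq //; exact: perm_inj.
  by apply: (uniq_min_size us sub_ss _).2; rewrite size_map.
- by rewrite cardT size_cat size_map.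
- by rewrite inE.
Qed.

Lemma galpi_neq0 J (psi : {scalar {mpoly k[npairs m n]}}) p :
  closure_form J psi -> psi p != 0 -> pi p <> 0.
Proof.
move=> psiJ psip; rewrite -(rmorph0 pi) => /galpi_eq; rewrite subr0.
by move/(closure_form_ideal psiJ) => psi0; rewrite psi0 eqxx in psip.
Qed.

Lemma zip_nseq (i0 : 'I_m) (ss : seq 'I_n) :
  zip (nseq (size ss) i0) ss = [seq (i0, s) | s <- ss].
Proof. by elim: ss => //= s ss ->. Qed.

(** The witness is x_(i0,s_1)...x_(i0,s_h) with h = n./2, multiplied for [n] odd
   by one variable with another first index. *)
Lemma socle_exists : (1 < m)%N -> (1 < n)%N ->
  exists q : G, [/\ q <> 0, in_socle q & in_degree (uphalf n) q].
Proof.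
move=> m_gt1 n_gt1; pose i0 : 'I_m := Ordinal m_gt1.
have size_n : size (enum 'I_n) = n by rewrite size_enum_ord.
have [n_odd | n_even] := boolP (odd n); last first.
  have nE : n = (n./2 + n./2)%N by rewrite addnn even_halfK.
  pose ss := take n./2 (enum 'I_n); pose ts := drop n./2 (enum 'I_n).
  have sss : size ss = n./2 by rewrite size_takel // size_n {2}nE leq_addr.
  have tss : size ts = size ss by rewrite size_drop size_n sss {1}nE addnK.
  have ust : uniq (ss ++ ts) by rewrite cat_take_drop enum_uniq.
  have uss : uniq ss by move: ust; rewrite cat_uniq => /andP[].
  pose l := [seq (i0, s) | s <- ss].
  have sl : size l = uphalf n.
    by rewrite size_map sss uphalf_half (negPf n_even).
  exists (mon l); split; last by rewrite -sl; exact: in_degree_mon.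
    have [phi phiJ phi1] := @closure_form_eval0 k m n.
    have c0s : size (nseq (size ss) i0) = size ss by rewrite size_nseq.
    have [a _|psi psiJ psiE] := closure_form_pairs phiJ tss c0s ust.
      by rewrite inE.
    rewrite -galpi_poly_mon; apply: (galpi_neq0 psiJ).
    rewrite -[poly_mon _]mulr1 /l -zip_nseq psiE // eqxx phi1 mulr1.
    exact: oner_neq0.
  by apply: (@mon_row_socle i0 [::]) => //; rewrite /= sss add0n -nE.
have nE : n = (n./2 + n./2).+1 by rewrite addnn -[LHS]odd_double_half n_odd.
have h_gt0 : (0 < n./2)%N by rewrite half_gt0.
have [b [t [rs enE]]] : exists b t rs, enum 'I_n = [:: b, t & rs].
  by move: size_n; case: (enum 'I_n) => [|b [|t rs]] size_rs;
    [rewrite -size_rs in n_gt1 | rewrite -size_rs in n_gt1 | exists b, t, rs].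
have srs : size rs = (n./2 + n./2).-1.
  by move: size_n; rewrite enE /= [in RHS]nE => -[<-].
pose ss := take n./2 rs; pose ts := drop n./2 rs.
have sss : size ss = n./2.
  by rewrite size_takel // srs -subn1 -addnBA // leq_addr.
have tss : size ts = (size ss).-1.
  by rewrite size_drop srs sss -subn1 -addnBA // addKn subn1.
have ubt : uniq [:: b, t & ss ++ ts] by rewrite cat_take_drop -enE enum_uniq.
pose c0 := nseq (size ss) i0.
have c0s : size c0 = size ss by rewrite size_nseq.
have [i [J [psi [psiJ psiE]]]] :=
  @closure_form_detect k m n b t ss ts c0 m_gt1 ubt tss c0s.
pose l := (i, b) :: [seq (i0, s) | s <- ss].
have sl : size l = uphalf n by rewrite /= size_map sss uphalf_half n_odd.
exists (mon l); split; last by rewrite -sl; exact: in_degree_mon.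
  rewrite -galpi_poly_mon; apply: (galpi_neq0 psiJ).
  by rewrite poly_mon_cons /= -zip_nseq psiE // eqxx oner_neq0.
apply: (@mon_row_socle i0 [:: (i, b)]) => [|a|].
- by move: ubt; rewrite /= cat_uniq => /and5P[_ _ ->].
- rewrite inE => /eqP->; move: ubt; rewrite /= !inE mem_cat !negb_or.
  by case/andP => /and3P[_ ->].
- by rewrite /= sss add1n addSn -nE.
Qed.

(** The permutation module on the products of [e] generators: a function on
   [e]-tuples of pairs maps onto the combination of products it describes. *)
Definition tuple_space (e : nat) := {ffun e.-tuple pair -> k^o}.

Definition tuple_act e (s : 'S_n) (v : tuple_space e) : tuple_space e :=
  [ffun l : e.-tuple pair => v (map_tuple (perm_pair s^-1) l)].

Lemma tuple_act_is_linear e s : linear (@tuple_act e s).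
Proof. by move=> c u v; apply/ffunP => l; rewrite !ffunE. Qed.

HB.instance Definition _ e s :=
  GRing.isLinear.Build k (tuple_space e) (tuple_space e) *:%R (@tuple_act e s)
    (@tuple_act_is_linear e s).

Lemma perm_pairM s t a :
  perm_pair (s * t) a = perm_pair t (perm_pair s a) :> pair.
Proof. by rewrite /perm_pair /= permM. Qed.

Lemma map_perm_pairK e s :
  cancel (@map_tuple e _ _ (@perm_pair m n s)) (map_tuple (perm_pair s^-1)).
Proof.
move=> l; apply: val_inj; rewrite /= -map_comp -[RHS]map_id.
by apply: eq_map => -[i j]; rewrite /perm_pair /= permK.
Qed.

Lemma tuple_act1 e v : @tuple_act e 1%g v = v.
Proof.
apply/ffunP => l; rewrite ffunE; congr (v _); apply: val_inj => /=.
rewrite invg1 -[RHS]map_id.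
by apply: eq_map => -[i j]; rewrite /perm_pair perm1.
Qed.

Lemma tuple_actM e s t v :
  @tuple_act e (s * t)%g v = tuple_act t (tuple_act s v).
Proof.
apply/ffunP => l; rewrite !ffunE; congr (v _); apply: val_inj => /=.
by rewrite -map_comp; apply: eq_map => a /=; rewrite invMg perm_pairM.
Qed.

Definition tuple_eval e (v : tuple_space e) : G :=
  \sum_(l : e.-tuple pair) (v l : k) *: mon l.

Lemma tuple_eval_is_linear e : linear (@tuple_eval e).
Proof.
move=> c u v; rewrite /tuple_eval scaler_sumr -big_split.
by apply: eq_bigr => l _; rewrite !ffunE scalerDl scalerA.
Qed.

HB.instance Definition _ e :=
  GRing.isLinear.Build k (tuple_space e) G *:%R (@tuple_eval e)
    (@tuple_eval_is_linear e).

Lemma tuple_eval_act e s v :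
  tuple_eval (@tuple_act e s v) = galact s (tuple_eval v).
Proof.
rewrite /tuple_eval (reindex_inj (can_inj (@map_perm_pairK e s))) raddf_sum /=.
apply: eq_bigr => l _; rewrite ffunE map_perm_pairK linearZ /=.
by rewrite galact_mon.
Qed.

Lemma tuple_eval_span e v : mon_span set0 e (@tuple_eval e v).
Proof.
apply: mon_span_sum => l _; apply: mon_spanZ; apply: MonSpan_mon.
  exact: size_tuple.
by apply/allP => a _; rewrite !inE.
Qed.

Lemma mon_span_tuple e q : mon_span set0 e q -> exists v, q = @tuple_eval e v.
Proof.
case/(@mon_span_sum_mon _ _ _ (e.-tuple pair) (fun l => mon l))=>
  [l le _|v ->].
  by right; exists (tcast le (in_tuple l)); case: e / le.
by exists v.
Qed.

Definition tuple_delta e (l : e.-tuple pair) : tuple_space e :=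
  [ffun l' => (l' == l)%:R : k^o].

Lemma tuple_deltaE e (v : tuple_space e) :
  v = \sum_l (v l : k) *: tuple_delta l.
Proof.
apply/ffunP => l; rewrite sum_ffunE (bigD1 l) //= big1 => [|l' ll'].
  by rewrite !ffunE eqxx addr0 [RHS]mulr1.
by rewrite !ffunE eq_sym (negPf ll') [LHS]mulr0.
Qed.

Lemma in_socle_lin (c : k) (u v : G) :
  in_socle u -> in_socle v -> in_socle (c *: u + v).
Proof.
by move=> su sv i j; rewrite mulrDr -scalerAr su sv scaler0 addr0.
Qed.

Lemma in_socle_galact s (u : G) : in_socle u -> in_socle (galact s u).
Proof.
move=> su i j; rewrite -[j](permKV s) -galact_x -rmorphM.
by rewrite su rmorph0.
Qed.

(** A nonzero socle element of degree [e] yields, by an equivariant projection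
   of the permutation module onto the preimage of the socle, a nonzero one that
   is invariant under the permutations of [n - e] positions [T], hence a
   combination of products avoiding [T]. *)
Lemma socle_inv e (q : G) : mon_span set0 e q -> in_socle q -> q <> 0 ->
  exists (T : {set 'I_n}) (u : G),
    [/\ (#|T| + e = n)%N, mon_span T e u, in_socle u & u <> 0].
Proof.
move=> qe q_soc q_neq0; have [v0 qE] := mon_span_tuple qe.
pose S (v : tuple_space e) := in_socle (tuple_eval v).
have [V VE] : exists V : {vspace tuple_space e}, forall v, v \in V <-> S v.
  apply: vspace_of_pred => [i j|c u v su sv].
    by rewrite linear0 mulr0.
  by rewrite /S linearP; exact: in_socle_lin.
have [|||p [pV p_id p_act]] :=
    @equivariant_proj k n (tuple_space e) (@tuple_act e) V char0.
- exact: tuple_act1.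
- exact: tuple_actM.
- move=> s v /VE sv; apply/VE; rewrite /S tuple_eval_act.
  exact: in_socle_galact.
(* The projection of some basis vector has nonzero image, since these images
   span one that contains [q]. *)
have [l0 l0_neq0] : exists l, tuple_eval (p (tuple_delta l)) <> 0.
  apply: contrapT => p0; apply: q_neq0.
  rewrite qE -(p_id v0); last by apply/VE; rewrite /S -qE.
  rewrite [v0]tuple_deltaE !linear_sum big1 // => l _.
  rewrite !linearZ /=.
  have [->|l_neq0] := eqVneq (tuple_eval (p (tuple_delta l))) 0.
    by rewrite scaler0.
  by case: p0; exists l; exact/eqP.
pose T : {set 'I_n} := [set j | j \notin unzip2 l0].
set u := tuple_eval _ in l0_neq0.
have uT s : perm_on T s -> galact s u = u.
  move=> sT; rewrite /u -tuple_eval_act -p_act; congr (tuple_eval (p _)).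
  apply/ffunP => l; rewrite !ffunE; congr (_ %:R); congr nat_of_bool.
  have fix0 t : perm_on T t -> map_tuple (perm_pair t) l0 = l0.
    move=> tT; apply: val_inj; rewrite /= -[RHS]map_id.
    apply/eq_in_map => -[i j] al0; rewrite /perm_pair /= (out_perm tT) //.
    by rewrite inE negbK; exact: (map_f snd al0).
  have sVT : perm_on T s^-1%g.
    by have := @groupV _ (Sym_group T) s; rewrite !inE sT.
  apply/eqP/eqP => [lE|->]; last exact: fix0.
  by rewrite -(fix0 s sT) -lE -{1}[s]invgK map_perm_pairK.
have uE : mon_span T e u by apply: mon_span_inv => //; exact: tuple_eval_span.
exists T, u; split=> //; last exact/VE.
(* [T] has at least n - e elements by construction, and no more since [u] would
   vanish. *)
apply/eqP; rewrite eqn_leq; apply/andP; split.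
  rewrite leqNgt addnC; apply/negP => lt_n; apply: l0_neq0.
  exact: mon_span_eq0 uE lt_n.
have : (#|~: T| <= e)%N.
  rewrite -[X in (_ <= X)%N](size_tuple l0) -(size_map snd) -/(unzip2 l0).
  apply: leq_trans (card_size _); apply/subset_leq_card/subsetP => j.
  by rewrite !inE negbK.
by rewrite cardsCs setCK card_ord leq_subLR.
Qed.

Lemma socle_degree_lt e (q : G) : (1 < m)%N -> (1 < n)%N ->
  (e.*2 < n)%N -> in_degree e q -> in_socle q -> q = 0.
Proof.
move=> m_gt1 n_gt1 lt_n /in_degree_mon_span qe q_soc; apply: contrapT => q_neq0.
have [T [u [cardT uT u_soc u_neq0]]] := socle_inv qe q_soc q_neq0.
pose ss := enum (~: T).
have sss : size ss = e.
  rewrite -cardE cardsCs setCK card_ord.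
  by have := congr1 (subn^~ #|T|) cardT; rewrite /= addKn => ->.
have [a uE] := mon_span_full sss uT.
have [c0 ac0] : exists c0, a c0 != 0.
  apply: contrapT => a0; apply: u_neq0; rewrite uE big1 // => c _.
  have [->|ac] := eqVneq (a c) 0; first by rewrite scale0r.
  by case: a0; exists c.
have sT : size (enum T) = (n - e)%N.
  by rewrite -cardE; have := congr1 (subn^~ e) cardT; rewrite /= addnK.
have le_T : (e < n - e)%N by rewrite ltn_subRL addnn.
have T_gt1 : (1 < n - e)%N.
  by have [->|e_gt0] := posnP e; [rewrite subn0 | apply: leq_ltn_trans le_T].
have [b [t [rs TE]]] : exists b t rs, enum T = [:: b, t & rs].
  by move: sT T_gt1; case: (enum T) => [|b [|t rs]] <- // _; exists b, t, rs.
pose ts := take e.-1 rs.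
have tss : size ts = (size ss).-1.
  rewrite sss size_takel //.
  have srs : (size rs).+2 = (n - e)%N by rewrite -sT TE.
  rewrite -ltnS -ltnS srs.
  by have [e0|/prednK->//] := posnP e; rewrite e0 in T_gt1 *.
have ubt : uniq [:: b, t & ss ++ ts].
  have btE : [:: b, t & ts] = take e.-1.+2 (enum T) by rewrite TE.
  have -> : uniq [:: b, t & ss ++ ts] = uniq ([:: b, t & ts] ++ ss).
    by apply: perm_uniq; rewrite /= !perm_cons perm_catC.
  rewrite cat_uniq enum_uniq btE take_uniq ?enum_uniq //= andbT.
  apply/hasPn => j; rewrite mem_enum inE; apply: contra => /mem_take.
  by rewrite mem_enum.
have c0s : size c0 = size ss by rewrite size_tuple.
have [i [J [psi [psiJ psiE]]]] :=
  @closure_form_detect k m n b t ss ts c0 m_gt1 ubt tss c0s.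
pose p := \sum_c a c *: (polyx k i b * poly_mon (zip c ss)).
apply: (galpi_neq0 psiJ _ (p := p)).
  rewrite linear_sum (bigD1 c0) //= linearZ /= psiE // eqxx mulr1.
  rewrite big1 ?addr0 //.
  move=> c c_neq; rewrite linearZ /= psiE; last by rewrite (size_tuple c) sss.
  by rewrite (inj_eq val_inj) (negPf c_neq) mulr0.
rewrite raddf_sum -[RHS](u_soc i b) uE mulr_sumr; apply: eq_bigr => c _.
by rewrite /= linearZ /= rmorphM /= galpi_poly_mon -scalerAr.
Qed.

End Socle.

(** * Copies of Specht modules *)

Section SpechtCopies.

Lemma tableau_row_leq n mu (t : tableau (n := n)) r : is_tableau mu t ->
  (#|[set a | ((t a).1 : nat) == r]| <= nth 0%N mu r)%N.
Proof.
case/andP=> /injectiveP t_inj /forallP t_mu; set T := [set _ | _].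
pose cols := [seq val (t a).2 | a <- enum T].
have -> : #|T| = size cols by rewrite size_map -cardE.
rewrite -[nth _ _ _](size_iota 0); apply: uniq_leq_size.
  rewrite map_inj_in_uniq ?enum_uniq // => a b.
  rewrite !mem_enum !inE => /eqP ta /eqP tb /val_inj tab.
  apply: t_inj; rewrite [t a]surjective_pairing [t b]surjective_pairing tab.
  by congr (_, _); apply: val_inj; rewrite /= ta tb.
move=> _ /mapP[a aT ->]; rewrite mem_iota /= add0n.
by move: aT; rewrite mem_enum inE => /eqP <-; exact: t_mu.
Qed.

Lemma tableau_row_size n mu (t : tableau (n := n)) r :
  sumn mu = n -> is_tableau mu t -> (r < size mu)%N ->
  #|[set a | ((t a).1 : nat) == r]| = nth 0%N mu r.
Proof.
move=> sum_mu tab_t r_lt.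
pose row (i : 'I_(size mu)) := [set a | ((t a).1 : nat) == i].
have sum_row : (\sum_i #|row i| = n)%N.
  under eq_bigr do rewrite /row -sum1_card big_mkcond.
  rewrite exchange_big /= -[RHS]card_ord -sum1_card; apply: eq_bigr => a _.
  have ta_lt : ((t a).1 < size mu)%N.
    rewrite ltnNge; apply/negP => /(nth_default 0%N) mu0.
    by case/andP: tab_t => _ /forallP/(_ a); rewrite mu0.
  rewrite (bigD1 (Ordinal ta_lt)) //= inE eqxx big1 // => i i_neq.
  by rewrite inE; case: eqP => // ta; case/eqP: i_neq; exact/val_inj/esym.
have sum_nth : (\sum_(i < size mu) nth 0%N mu i = n)%N.
  by rewrite -[RHS]sum_mu sumnE (big_nth 0%N) big_mkord.
have /leqif_sum : forall i, true ->
    (#|row i| <= nth 0%N mu i ?= iff (#|row i| == nth 0%N mu i))%N.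
  by move=> i _; apply: leqif_eq; exact: tableau_row_leq.
case=> _; rewrite sum_row sum_nth eqxx => /esym/forallP/(_ (Ordinal r_lt)).
by move/eqP.
Qed.

Context {k : fieldType} {m n : nat}.
Context (char0 : [pchar k] =i pred0).
Local Notation G := (galclos k m n).

Lemma perm_act1 (v : tabloid_space (k := k) (n := n)) : perm_act 1%g v = v.
Proof.
apply/ffunP => r; rewrite ffunE; congr (v _).
by apply/ffunP => a; rewrite ffunE perm1.
Qed.

Lemma perm_actM s t (v : tabloid_space (k := k) (n := n)) :
  perm_act (s * t)%g v = perm_act t (perm_act s v).
Proof.
apply/ffunP => r; rewrite !ffunE; congr (v _).
by apply/ffunP => a; rewrite !ffunE permM.
Qed.

(** A copy of V_mu extends, through an equivariant projection, to a map defined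
   on all tabloids. The image of a tabloid is invariant under the permutations
   of each row, so a generator whose position avoids a row of size at least
   [n - e] kills it. The first two rows are such, and every position avoids at
   least one of them. *)
Lemma specht_copy_socle mu e (W : G -> Prop) :
  sumn mu = n -> (1 < size mu)%N ->
  (n <= e + nth 0%N mu 0)%N -> (n <= e + nth 0%N mu 1)%N ->
  is_copy_of_specht mu W -> (forall q, W q -> in_degree e q) ->
  forall q, W q -> in_socle q.
Proof.
move=> sum_mu size_mu le0 le1 [_ [f [_ fW f_act]]] We.
have [|||p [pV p_id p_act]] :=
    @equivariant_proj k n (tabloid_space (k := k) (n := n))
      (fun s => perm_act s) (specht k n mu) char0.
- exact: perm_act1.
- exact: perm_actM.
- move=> s v; exact: specht_stable.
pose g v := f (vsproj (specht k n mu) (p v)).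
have g_act s v : g (perm_act s v) = galact s (g v).
  rewrite /g p_act -f_act; congr (f _); apply: val_inj => /=.
  by rewrite vsval_specht_act !vsprojK ?specht_stable.
have gW v : W (g v) by apply/fW; exists (vsproj (specht k n mu) (p v)).
have g_tab t i j :
    is_tableau mu t -> galx i j * g (tabloid_vec (tabloid_of t)) = 0.
  move=> tab_t; pose T (r : nat) := [set a | ((t a).1 : nat) == r].
  have kill r : (r < size mu)%N -> (n <= e + nth 0%N mu r)%N -> j \notin T r ->
      galx i j * g (tabloid_vec (tabloid_of t)) = 0.
    move=> r_lt r_le jT; apply: (@galx_inv_eq0 _ _ _ (T r) e) => //.
    - exact/in_degree_mon_span/We/gW.
    - move=> s sT; rewrite -g_act perm_act_tabloid; congr (g (tabloid_vec _)).
      apply/ffunP => a; rewrite !ffunE.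
      have sVT : perm_on (T r) s^-1%g.
        by have := @groupV _ (Sym_group (T r)) s; rewrite !inE sT.
      have [aT|aT] := boolP (a \in T r); last by rewrite (out_perm sVT aT).
      have := perm_closed a sVT; rewrite aT; move: aT; rewrite !inE.
      by move=> /eqP ta /eqP tsa; apply: val_inj; rewrite /= tsa.
    - by rewrite (tableau_row_size sum_mu tab_t r_lt).
  have [j0|j0] := boolP (j \in T 0%N); last exact: (kill 0%N (ltnW size_mu)).
  apply: (kill 1%N) => //; move: j0; rewrite !inE => /eqP->.
  by [].
move=> q /fW[v <-] i j.
have -> : f v = g (vsval v) by rewrite /g p_id ?subvsP // vsvalK.
have : vsval v \in specht k n mu by exact: subvsP.
move: (vsval v) => {v} w.
have g_lin : linear g by move=> c u v; rewrite /g !linearP.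
pose gL : {linear tabloid_space (k := k) (n := n) -> G} :=
  HB.pack g (GRing.isLinear.Build k _ G *:%R g g_lin).
rewrite -[g w]/(gL w) => /coord_span ->.
rewrite linear_sum mulr_sumr big1 // => a _; rewrite linearZ -scalerAr.
set X := map_tuple _ _; have aX : (a < size X)%N by rewrite size_tuple.
have /mapP[t tab_t /= ->] := mem_nth 0 aX; rewrite mem_enum in tab_t.
rewrite -[g _]/(gL _) /polytabloid linear_sum mulr_sumr big1 ?scaler0 // => s _.
rewrite linearZ -scalerAr -perm_act_tabloid /= g_act.
by rewrite -[j](permKV s) -galact_x -rmorphM /= g_tab // rmorph0 scaler0.
Qed.

End SpechtCopies.

Local Close Scope ring_scope.

Theorem theorem5p1 (k : closedFieldType) (m n : nat)
    (char0 : [pchar k]%R =i pred0) (n_ge4 : 4 <= n) (n_le : n <= m.+1) :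
  let D := uphalf n in
  let mu := if odd n then [:: D.-1; D.-1; 1] else [:: D; D] in
  [/\ exists q : galclos k m n,
        [/\ q <> 0%R, in_socle q & in_degree D q],
      forall (e : nat) (q : galclos k m n),
        e < D -> in_degree e q -> in_socle q -> q = 0%R
    & forall d : 'I_m -> nat, \sum_(i < m) d i = D ->
        forall W : galclos k m n -> Prop,
        is_copy_of_specht mu W ->
        (forall q, W q -> in_multidegree d q) ->
        forall q, W q -> in_socle q].
Proof.
move=> D mu.
have n_gt1 : 1 < n by apply: leq_trans n_ge4.
have m_gt1 : 1 < m.
  by rewrite -ltnS; apply: leq_trans n_le; apply: leq_trans n_ge4.
have nE : odd n + n./2 + n./2 = n by rewrite -addnA addnn odd_double_half.
have DE : D = odd n + n./2 by exact: uphalf_half.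
split; first exact: socle_exists.
  move=> e q e_lt; apply: socle_degree_lt => //.
  by rewrite ltnNge leq_uphalf_double -ltnNge in e_lt.
move=> d sum_d W copyW Wd q Wq.
have W_deg u : W u -> in_degree D u.
  by rewrite -sum_d => /Wd; exact: in_multidegree_degree.
(* Both parities have two first rows of size n./2 = n - D. *)
have [mu0 mu1] : nth 0 mu 0 = n./2 /\ nth 0 mu 1 = n./2.
  by rewrite /mu DE; case: (odd n).
apply: (specht_copy_socle char0 _ _ _ _ copyW W_deg Wq);
  rewrite ?mu0 ?mu1 ?DE ?nE //.
  rewrite /mu DE -[RHS]nE; case: (odd n) => /=; rewrite ?addn0 //.
  by rewrite addn1 !addnS.
by rewrite /mu; case: (odd n).
Qed.
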